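(* Fix $c>0$ and an integer $K\ge1$, and let $p_n=c/n$. For the SFAP exploration algorithm on $n$ vertices (described in the context), let $A_k(t)=|\mathcal{A}_k(t)|$ and $\alpha^n_k(t)=A_k(\lfloor nt\rfloor)/n$ for $t\in[0,1]$, $1\le k\le K$, and $\boldsymbol\alpha^n(t)=(\alpha^n_1(t),\dots,\alpha^n_K(t))$. For $\boldsymbol\alpha=(\alpha_1,\dots,\alpha_K)$ and $1\le k\le K$ define $$\delta_k(\boldsymbol\alpha)=e^{-c\alpha_k}\prod_{r=1}^{k-1}\big(1-e^{-c\alpha_r}\big).$$ Then the integral equations $\alpha_k(t)=\int_0^t\delta_k(\boldsymbol\alpha(s))\,ds$, $1\le k\le K$, $t\in[0,1]$, have a unique solution $\boldsymbol\alpha(t)$, and the process $\{\boldsymbol\alpha^n(t)\}_{0\le t\le1}$ converges in distribution (uniformly on $[0,1]$) to the deterministic process $\{\boldsymbol\alpha(t)\}_{0\le t\le1}$. Consequently, if $N_k(n)$ is the number of vertices using frequency $k$ in the final state of the SFAP model on $G(n,c/n)$, then for all $1\le k\le K$, $N_k(n)/n\to\alpha_k(1)$ in distribution as $n\to\infty$.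
   Context: Empty products equal one. $G(n,p_n)$ is the Erdős–Rényi random graph on $[n]$ with independent edge probability $p_n$. SFAP model: given $G(n,p_n)$, vertices are selected one at a time uniformly at random among those not yet selected; a selected vertex receives the smallest frequency in $\{1,\dots,K\}$ not used by any of its neighbours, and if all $K$ frequencies are used by neighbours it gets no frequency (frozen). $N_k(n)$ is the number of vertices with frequency $k$ after all $n$ vertices are selected. SFAP exploration algorithm: maintain $\mathcal{A}_k(t)$ ($1\le k\le K$: explored vertices with frequency $k$; $\mathcal{A}_0(t)$: explored frozen vertices) and unexplored set $\mathcal{U}(t)$, initially empty and $[n]$. At step $t+1$, select $v\in\mathcal{U}(t)$ uniformly, remove it from $\mathcal{U}$, join it to each explored vertex independently with probability $p_n$; let $\mathcal{F}_v$ be $\{1,\dots,K\}$ minus the set of $k\ge1$ such that $v$ is joined to some vertex of $\mathcal{A}_k(t)$; if $\mathcal{F}_v\neq\varnothing$, $v$ joins $\mathcal{A}_{\min\mathcal{F}_v}$, otherwise $v$ joins $\mathcal{A}_0$. Convergence in distribution of processes is understood as uniform convergence over compact sets. *)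

(* Defs.v *)
From HB Require Import structures.
From mathcomp Require Import all_boot all_order all_algebra all_fingroup.
From mathcomp Require Import all_classical all_reals all_analysis.

Set Implicit Arguments.
Unset Strict Implicit.
Unset Printing Implicit Defensive.

Import Order.TTheory GRing.Theory Num.Theory.
Import numFieldNormedType.Exports.
Local Open Scope classical_set_scope.
Local Open Scope ring_scope.

(* Finite probability space for the SFAP model / exploration algorithm on   *)
(* n vertices (vertices are 'I_n, i.e. {0,..,n-1}):                         *)
(*  - sigma : {perm 'I_n}  : sigma i is the vertex selected at step i+1     *)
(*            (uniform random selection order among unselected vertices);   *)
(*  - E     : edge set of G(n,p), edges stored as pairs (i,j) with i < j,   *)
(*            each present independently with probability p.                *)
Definition Omega (n : nat) : finType :=
  ({perm 'I_n} * {set ('I_n * 'I_n)})%type.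

Definition pairs_lt (n : nat) : {set ('I_n * 'I_n)} :=
  [set e : 'I_n * 'I_n | (val e.1 < val e.2)%N].

(* edge probability p_n = c/n (capped at 1, only relevant when n < c) *)
Definition pn {R : realType} (c : R) (n : nat) : R := Num.min 1 (c / n%:R).

Definition Prob {R : realType} (c : R) (n : nat) (w : Omega n) : R :=
  let p := pn c n in
  let E := w.2 in
  (n`!%:R)^-1 *
  (if E \subset pairs_lt n
   then p ^+ #|E| * (1 - p) ^+ (#|pairs_lt n| - #|E|)
   else 0).

Definition Expect {R : realType} (c : R) (n : nat) (X : Omega n -> R) : R :=
  \sum_(w : Omega n) Prob c w * X w.

(* vertex (as a nat) selected at step t+1 (t = 0, ..., n-1) *)
Definition sel (n : nat) (sigma : {perm 'I_n}) (t : nat) : nat :=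
  if (insub t : option 'I_n) is Some i then val (sigma i) else 0%N.

Definition adjn (n : nat) (E : {set ('I_n * 'I_n)}) (u v : nat) : bool :=
  [exists e in E, ((val e.1 == u) && (val e.2 == v))
                  || ((val e.1 == v) && (val e.2 == u))].

(* frequency k is used by a neighbour of the step-(t+1) vertex among the t
   already explored vertices, whose frequencies are listed in cs
   (cs`_s = frequency of the vertex selected at step s+1; 0 = frozen). *)
Definition used (n : nat) (w : Omega n) (cs : seq nat) (t k : nat) : bool :=
  has (fun s => (nth 0%N cs s == k) && adjn w.2 (sel w.1 s) (sel w.1 t))
      (iota 0 t).

(* smallest free frequency in {1..K}, or 0 (frozen) if there is none *)
Definition newfreq (K n : nat) (w : Omega n) (cs : seq nat) (t : nat) : nat :=
  nth 0%N [seq k <- iota 1 K | ~~ used w cs t k] 0.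

Fixpoint freqs (K n : nat) (w : Omega n) (t : nat) : seq nat :=
  match t with
  | 0 => [::]
  | t'.+1 => let cs := freqs K w t' in rcons cs (newfreq K w cs t')
  end.

Definition Acount (K n : nat) (w : Omega n) (k t : nat) : nat :=
  count_mem k (freqs K w t).

Definition alpha_n {R : realType} (K n : nat) (w : Omega n) (k : nat) (t : R)
  : R := (Acount K w k (Num.truncn (n%:R * t)))%:R / n%:R.

(* N_k(n): number of vertices with frequency k once all n vertices are
   selected (SFAP final state) *)
Definition Nfreq (K n : nat) (w : Omega n) (k : nat) : nat := Acount K w k n.

Definition delta {R : realType} (c : R) (k : nat) (a : nat -> R) : R :=
  expR (- (c * a k)) * \prod_(1 <= r < k) (1 - expR (- (c * a r))).

Definition is_solution {R : realType} (c : R) (K : nat) (a : nat -> R -> R)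
  : Prop :=
  forall k, (1 <= k <= K)%N ->
    {within `[0, 1], continuous (a k)} /\
    forall t, t \in `[0, 1] ->
      (a k t)%:E = (\int[@lebesgue_measure R]_(s in `[0%R, t])
                      (delta c k (fun r => a r s))%:E)%E.

Definition unif_cont_bounded {R : realType} (K : nat)
  (F : (nat -> R -> R) -> R) : Prop :=
  (exists M : R, forall x, `|F x| <= M) /\
  forall x (eps : R), 0 < eps -> exists2 d : R, 0 < d &
    forall y, (forall k t, (1 <= k <= K)%N -> t \in `[0, 1] ->
                 `|x k t - y k t| < d) ->
      `|F x - F y| < eps.

Definition proc_cvg_dist {R : realType} (c : R) (K : nat)
  (a : nat -> R -> R) : Prop :=
  forall F, unif_cont_bounded K F ->
    (fun n => Expect c (fun w : Omega n => F (fun k t => alpha_n K w k t)))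
      @ \oo --> F a.

Definition cvg_dist_const {R : realType} (c : R)
  (X : forall n, Omega n -> R) (l : R) : Prop :=
  forall f : R -> R, continuous f -> (exists M : R, forall x, `|f x| <= M) ->
    (fun n => Expect c (fun w : Omega n => f (X n w))) @ \oo --> f l.

(* Main.v *)
(* Conditionally on the first t steps, the edges from the next vertex to the
   explored ones are fresh Bernoulli variables, so frequency k is chosen with
   probability (1-p)^(A_k) * prod_(r<k) (1 - (1-p)^(A_r)), which is
   delta_k(A/n) up to O(1/n). Hence the mean square S(t) of
   A(t)/n - alpha(t/n) satisfies S(t+1) <= (1 + C/n) S(t) + C/n^2, and
   S(t) <= exp(C)/n for all t <= n. As A/n and alpha are Lipschitz, controlling
   S on a grid with a bounded number of points gives uniform convergence. The
   integral equations are triangular: exp(c alpha_k) has derivative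
   c * prod_(r<k) (1 - exp(-c alpha_r)), which involves only the previous
   components and yields both existence and uniqueness. *)

Require Import Defs.
From HB Require Import structures.
From mathcomp Require Import all_boot all_order all_algebra all_fingroup.
From mathcomp Require Import all_classical all_reals all_analysis.
From mathcomp Require Import ring lra zify.

Import Order.TTheory GRing.Theory Num.Theory.
Import numFieldNormedType.Exports.
Local Open Scope classical_set_scope.
Local Open Scope ring_scope.

(** * The conditional law of the next frequency *)

(** This is the edge factor of [Prob] over a general finite ground set, so that edges can be summed
    out for a fixed selection order. *)
Definition bern {R : realType} {T : finType} (p : R) (S E : {set T}) : R :=
  if E \subset S then p ^+ #|E| * (1 - p) ^+ (#|S| - #|E|) else 0.

(** Pair each [E] avoiding [e] with [e |: E]: [f] takes the same value on both, and [E] carries a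
    fraction [1 - p] of the weight of the pair. *)
Lemma bern_notin {R : realType} {T : finType} (p : R) (S : {set T}) (e : T)
    (f : {set T} -> R) :
  e \in S -> (forall E : {set T}, f (e |: E) = f E) ->
  \sum_(E : {set T}) bern p S E * (f E * (e \notin E)%:R) =
  (1 - p) * \sum_(E : {set T}) bern p S E * f E.
Proof.
move=> eS fe; rewrite (bigID (fun E : {set T} => e \in E)) /= big1 ?add0r; last first.
  by move=> E ->; rewrite !mulr0.
rewrite [in RHS](bigID (fun E : {set T} => e \in E)) /=.
rewrite [X in _ = _ * (X + _)](reindex_onto (fun E => e |: E) (fun E => E :\ e)) /=; last first.
  by move=> E eE; rewrite finset.setD1K.
rewrite [X in _ = _ * (X + _)](eq_bigl (fun E : {set T} => e \notin E)); last first.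
  move=> E; rewrite finset.setU11 /=; apply/eqP/idP => [<-|eE]; first by rewrite !inE eqxx.
  by rewrite finset.setU1K.
rewrite -big_split mulr_sumr; apply: eq_bigr => E eE /=.
rewrite eE mulr1 fe /bern finset.subUset finset.sub1set eS /=.
case: ifP => ES; last by rewrite !mul0r addr0 mulr0.
rewrite cardsU1 eE /= add1n.
(* Strictness keeps the truncated subtraction in the exponent of [1 - p] exact. *)
have lt : (#|E| < #|S|)%N.
  by apply: proper_card; apply/properP; split => //; exists e.
have -> : (#|S| - #|E| = (#|S| - #|E|.+1).+1)%N by lia.
by rewrite !exprS; ring.
Qed.

(** Elements of [D] are removed one at a time with [bern_notin]. The indicator of [e \notin E] is
    absorbed into [f], which stays insensitive to the remaining elements of [D]. *)
Lemma bern_disjoint {R : realType} {T : finType} (p : R) (S D : {set T})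
    (f : {set T} -> R) :
  D \subset S -> (forall e (E : {set T}), e \in D -> f (e |: E) = f E) ->
  \sum_(E : {set T}) bern p S E * (f E * [disjoint E & D]%B%:R) =
  (1 - p) ^+ #|D| * \sum_(E : {set T}) bern p S E * f E.
Proof.
move: {2}#|D| (erefl #|D|) => m; elim: m D f => [|m IH] D f cD DS fD.
  rewrite cD expr0 mul1r; apply: eq_bigr => E _.
  by rewrite (cards0_eq cD) finset.disjoints_subset finset.setC0 finset.subsetT mulr1.
have /card_gt0P[e eD] : (0 < #|D|)%N by rewrite cD.
have cD' : #|D :\ e| = m by move: cD; rewrite (cardsD1 e) eD add1n => -[].
have dE (E : {set T}) : [disjoint E & D]%B = (e \notin E) && [disjoint E & D :\ e]%B.
  rewrite -{1}(finset.setD1K eD) !(fintype.disjoint_sym E).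
  rewrite -finset.setI_eq0 finset.setIUl finset.setU_eq0 -!finset.setI_eq0.
  congr (_ && _); rewrite finset.setI_eq0 finset.disjoints_subset finset.sub1set inE //.
transitivity (\sum_(E : {set T}) bern p S E * ((f E * (e \notin E)%:R) * [disjoint E & D :\ e]%B%:R)).
  by apply: eq_bigr => E _; rewrite dE -mulnb natrM !mulrA.
rewrite IH //; first last.
- move=> e' E; rewrite !inE => /andP[ne e'D].
  by rewrite fD // (eq_sym e) (negbTE ne).
- exact: fintype.subset_trans (finset.subsetDl _ _) DS.
rewrite bern_notin; [|exact: (fintype.subsetP DS)|by move=> E; apply: fD].
by rewrite mulrA cD cD' exprSr.
Qed.

(* V contains the edges that g and D do not look at: summing first over the
   trace of E outside V makes D constant. *)
Lemma bern_resample {R : realType} {T : finType} (p : R) (S V : {set T})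
    (g : {set T} -> R) (D : {set T} -> {set T}) :
  (forall E : {set T}, D E \subset S :&: V) ->
  (forall E : {set T}, g (E :\: V) = g E) -> (forall E, D (E :\: V) = D E) ->
  \sum_(E : {set T}) bern p S E * (g E * [disjoint E & D E]%B%:R) =
  \sum_(E : {set T}) bern p S E * (g E * (1 - p) ^+ #|D E|).
Proof.
move=> DSV gV DV.
rewrite (partition_big (fun E => E :\: V) predT) //=.
rewrite [RHS](partition_big (fun E => E :\: V) predT) //=.
apply: eq_bigr => E0 _.
(* Within the class of [E0] both [g] and [D] are constant. Class membership becomes an indicator
   that adding elements of [V] does not change, as [bern_disjoint] requires. *)
transitivity (\sum_(E : {set T}) bern p S E * (g E0 * (E :\: V == E0)%:R * [disjoint E & D E0]%B%:R)).
  rewrite big_mkcond /=; apply: eq_bigr => E _.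
  case: eqP => [<-|_]; last by rewrite mulr0 mul0r mulr0.
  by rewrite gV DV mulr1.
rewrite bern_disjoint; first last.
- move=> e E /(fintype.subsetP (DSV E0)); rewrite inE => /andP[_ eV].
  rewrite finset.setDUl (_ : [set e] :\: V = finset.set0) ?finset.set0U //.
  by apply/eqP; rewrite finset.setD_eq0 finset.sub1set.
- exact: fintype.subset_trans (DSV E0) (finset.subsetIl _ _).
rewrite mulr_sumr [RHS]big_mkcond /=; apply: eq_bigr => E _.
case: eqP => [<-|_]; last by rewrite !(mulr0, mul0r).
by rewrite gV DV mulr1; ring.
Qed.

(** Take [D = S] and [f = 1] in [bern_disjoint]: only the empty set contributes on the left, with
    weight [(1 - p) ^+ #|S|], and [p < 1] allows division by it. *)
Lemma bern_sum1 {R : realType} {T : finType} (p : R) (S : {set T}) :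
  p < 1 -> \sum_(E : {set T}) bern p S E = 1.
Proof.
move=> p1; have := @bern_disjoint R T p S S (fun=> 1) (fintype.subxx _) (fun _ _ _ => erefl).
rewrite (bigD1 finset.set0) //= big1 ?addr0; last first.
  move=> E E0; rewrite /bern; case: ifP => ES; last by rewrite mul0r.
  rewrite -finset.setI_eq0; move/finset.setIidPl : ES => ->.
  by rewrite (negbTE E0) !mulr0.
rewrite /bern finset.sub0set cards0 subn0 expr0 !mul1r -finset.setI_eq0 finset.set0I eqxx mulr1.
under [in RHS]eq_bigr do rewrite mulr1.
move=> /(congr1 (fun z => z / (1 - p) ^+ #|S|)).
have q0 : (1 - p) ^+ #|S| != 0 by rewrite expf_neq0 // lt0r_neq0 // subr_gt0.
by rewrite divff // mulrAC divff // mul1r.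
Qed.

(** * Edges at the next selected vertex *)

Lemma size_freqs (K n : nat) (w : Omega n) (t : nat) : size (freqs K w t) = t.
Proof. by elim: t => //= t IH; rewrite size_rcons IH. Qed.

Lemma selE {n : nat} (sigma : {perm 'I_n}) (i : 'I_n) : sel sigma i = sigma i.
Proof. by rewrite /sel valK. Qed.

Lemma sel_neq {n : nat} (sigma : {perm 'I_n}) {s t : nat} :
  (s < t)%N -> (t < n)%N -> sel sigma s != sel sigma t.
Proof.
move=> st tn; have sn := ltn_trans st tn.
rewrite (selE sigma (Ordinal sn)) (selE sigma (Ordinal tn)).
rewrite (inj_eq val_inj) (inj_eq perm_inj) -(inj_eq val_inj) /=.
by rewrite ltn_eqF.
Qed.

Definition star (n z : nat) : {set 'I_n * 'I_n} :=
  [set e : 'I_n * 'I_n | (val e.1 == z) || (val e.2 == z)].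

Lemma adjn_star (n : nat) (E : {set 'I_n * 'I_n}) (z u v : nat) :
  u != z -> v != z -> adjn (E :\: star n z) u v = adjn E u v.
Proof.
move=> uz vz; apply/existsP/existsP => -[[e1 e2]] /= /andP[eE h].
  by exists (e1, e2); rewrite h andbT; move: eE; rewrite inE => /andP[].
exists (e1, e2); rewrite h andbT !inE eE andbT /=.
by case/orP: h => /andP[/eqP-> /eqP->]; rewrite negb_or ?uz ?vz.
Qed.

(** The first [t] frequencies depend only on adjacencies among the first [t] selected vertices, all
    distinct from the next one. So the edges at the next vertex are still unexamined, and [star] can
    serve as [V] in [bern_resample]. *)
Lemma freqs_star (K n : nat) (sigma : {perm 'I_n}) (E : {set 'I_n * 'I_n})
    (t : nat) : (t < n)%N ->
  freqs K (sigma, E :\: star n (sel sigma t)) t = freqs K (sigma, E) t.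
Proof.
move=> tn; suff h t' : (t' <= t)%N ->
    freqs K (sigma, E :\: star n (sel sigma t)) t' = freqs K (sigma, E) t'.
  exact: h.
elim: t' => //= t' IH t't; rewrite IH ?(ltnW t't) //; congr rcons.
rewrite /newfreq; congr nth; apply: eq_filter => k; congr (~~ _).
apply: eq_in_has => s; rewrite mem_iota /= add0n => st'; congr (_ && _).
by apply: adjn_star; apply: sel_neq => //; apply: ltn_trans t't.
Qed.

(** For distinct endpoints, the orientation under which [pairs_lt] stores the edge. *)
Definition edge {n : nat} (u v : 'I_n) : 'I_n * 'I_n :=
  if (u < v)%N then (u, v) else (v, u).

Lemma adjn_edge (n : nat) (E : {set 'I_n * 'I_n}) (u v : 'I_n) :
  E \subset pairs_lt n -> adjn E u v = (edge u v \in E).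
Proof.
move=> /fintype.subsetP Elt; apply/existsP/idP => [[[e1 e2]] /= /andP[eE]|].
  have := Elt _ eE; rewrite inE /= => lt.
  case/orP => /andP[/eqP/val_inj e1E /eqP/val_inj e2E]; move: lt eE; rewrite e1E e2E /edge.
    by move=> ->.
  by move=> vu; rewrite ltnNge (ltnW vu).
rewrite /edge; case: ifP => _ h; [exists (u, v)|exists (v, u)];
  by rewrite h /= !eqxx ?orbT.
Qed.

Lemma edge_inj {n : nat} (v : 'I_n) : injective (edge^~ v).
Proof.
move=> u u'; rewrite /edge; case: ltnP => h; case: ltnP => h' [] //.
  by move=> <- ->.
by move=> -> <-.
Qed.

(* The edges whose absence means that no frequency of L is used by an explored
   neighbour of sigma t. *)
Definition edges_to {n : nat} (sigma : {perm 'I_n}) (cs L : seq nat) (t : 'I_n)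
    : {set 'I_n * 'I_n} :=
  [set edge (sigma s) (sigma t) | s in
     [set s : 'I_n | (s < t)%N && (nth 0%N cs s \in L)]%SET]%SET.

Lemma edges_to_sub {n : nat} (sigma : {perm 'I_n}) (cs L : seq nat) (t : 'I_n) :
  edges_to sigma cs L t \subset pairs_lt n :&: star n (sel sigma t).
Proof.
apply/fintype.subsetP => e /imsetP[s]; rewrite inE => /andP[st _] ->.
have := sel_neq sigma st (ltn_ord t); rewrite !selE => ne.
rewrite finset.in_setI; apply/andP; split; rewrite inE ?selE /edge; case: (ltnP (sigma s) (sigma t)) => h //=.
- by rewrite ltn_neqAle h andbT eq_sym.
- by rewrite eqxx orbT.
- by rewrite eqxx.
Qed.

Lemma card_edges_to {n : nat} (sigma : {perm 'I_n}) (cs L : seq nat) (t : 'I_n) :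
  size cs = t -> #|edges_to sigma cs L t| = count [in L] cs.
Proof.
move=> csz; rewrite card_imset; last by move=> s s' /edge_inj/perm_inj.
rewrite -sum1_card -sum1_count (big_nth 0%N) csz big_mkord.
rewrite (big_ord_widen_cond n (fun i => nth 0%N cs i \in L) (fun=> 1%N)); last exact: ltnW.
by apply: eq_bigl => s; rewrite inE andbC.
Qed.

Lemma disjoint_edges_to {n : nat} (sigma : {perm 'I_n}) (E : {set 'I_n * 'I_n})
    (cs L : seq nat) (t : 'I_n) : E \subset pairs_lt n ->
  [disjoint E & edges_to sigma cs L t]%B =
  all (fun r => ~~ used (sigma, E) cs t r) L.
Proof.
move=> Elt; apply/idP/allP => [dis r rL|h].
  apply/hasPn => s; rewrite mem_iota add0n /= => st.
  have sn := ltn_trans st (ltn_ord t).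
  rewrite negb_and; case: eqP => //= csr.
  rewrite (selE sigma (Ordinal sn)) selE adjn_edge //.
  apply/negP => eE; have /negP[] := negbT (disjointFr dis eE).
  by apply/imsetP; exists (Ordinal sn); rewrite // inE /= st csr.
rewrite fintype.disjoint_sym finset.disjoints_subset.
apply/fintype.subsetP => e /imsetP[s]; rewrite inE => /andP[st sL] ->.
rewrite inE -adjn_edge //; have := h _ sL; apply: contra => ad.
apply/hasP; exists (val s); first by rewrite mem_iota add0n.
by rewrite eqxx !selE.
Qed.

(** The selection order is independent of the edges, so it may be fixed while the edges are summed
    out. *)
Lemma Expect_eq {R : realType} {c : R} {n : nat} (X Y : Omega n -> R) :
  (forall sigma, \sum_E bern (pn c n) (pairs_lt n) E * X (sigma, E) =
                 \sum_E bern (pn c n) (pairs_lt n) E * Y (sigma, E)) ->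
  Expect c X = Expect c Y.
Proof.
have fold Z : Expect c Z = \sum_(sigma : {perm 'I_n}) n`!%:R^-1 *
    \sum_E bern (pn c n) (pairs_lt n) E * Z (sigma, E).
  under [RHS]eq_bigr do rewrite mulr_sumr.
  by rewrite pair_bigA; apply: eq_bigr => -[s E] _; rewrite mulrA.
by move=> h; rewrite !fold; apply: eq_bigr => s _; rewrite h.
Qed.

Lemma count_mem_sum (L cs : seq nat) :
  uniq L -> count [in L] cs = (\sum_(r <- L) count_mem r cs)%N.
Proof.
move=> uL; elim: cs => [|x cs IH] /=; first by rewrite big1.
rewrite big_split /= -IH; congr addn.
rewrite -(count_uniq_mem x uL) -sumn_count sumnE big_map.
by apply: eq_bigr => r _; rewrite /= eq_sym.
Qed.

(** All frequencies of [L] are free exactly when the edges of [edges_to] are absent. These lie at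
    the next vertex and are invisible to the history, so [bern_resample] replaces the event by its
    conditional probability. *)
Lemma Expect_unused {R : realType} (c : R) (K n t : nat) (phi : seq nat -> R)
    (L : seq nat) : (t < n)%N -> uniq L ->
  Expect c (fun w : Omega n => phi (freqs K w t) *
     \prod_(r <- L) (~~ used w (freqs K w t) t r)%:R) =
  Expect c (fun w : Omega n => phi (freqs K w t) *
     \prod_(r <- L) (1 - pn c n) ^+ count_mem r (freqs K w t)).
Proof.
move=> tn uL; apply: Expect_eq => sigma; pose i := Ordinal tn.
pose cs E := freqs K (sigma, E) t.
have csV E : cs (E :\: star n (sel sigma t)) = cs E by exact: freqs_star.
transitivity (\sum_(E : {set 'I_n * 'I_n}) bern (pn c n) (pairs_lt n) E *
    (phi (cs E) * [disjoint E & edges_to sigma (cs E) L i]%B%:R)).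
  apply: eq_bigr => E _; rewrite /bern; case: ifP => [Elt|]; last by rewrite !mul0r.
  rewrite (disjoint_edges_to sigma) //; congr (_ * (_ * _)).
  by elim: L {uL} => [|r L IH]; rewrite ?big_nil ?big_cons //= IH -natrM mulnb.
rewrite (bern_resample _ _ (star n (sel sigma t))); first last.
- by move=> E; rewrite csV.
- by move=> E; rewrite csV.
- by move=> E; exact: edges_to_sub.
apply: eq_bigr => E _; congr (_ * (_ * _)).
rewrite card_edges_to ?size_freqs // count_mem_sum //.
by elim: L {uL} => [|r L IH]; rewrite ?big_nil ?big_cons ?expr0 // exprD IH.
Qed.

Lemma Expect_sub {R : realType} {c : R} {n : nat} (X Y : Omega n -> R) :
  Expect c (fun w => X w - Y w) = Expect c X - Expect c Y.
Proof. by rewrite /Expect -sumrB; apply: eq_bigr => w _; rewrite mulrBr. Qed.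

(** [L] lists frequencies required to be free and [M] those required to be used; inclusion-exclusion
    over [M] reduces to [Expect_unused]. *)
Lemma Expect_used {R : realType} (c : R) (K n t : nat) (phi : seq nat -> R)
    (L M : seq nat) : (t < n)%N -> uniq (M ++ L) ->
  Expect c (fun w : Omega n => phi (freqs K w t) *
     ((\prod_(r <- L) (~~ used w (freqs K w t) t r)%:R) *
      \prod_(r <- M) (1 - (~~ used w (freqs K w t) t r)%:R))) =
  Expect c (fun w : Omega n => phi (freqs K w t) *
     ((\prod_(r <- L) (1 - pn c n) ^+ count_mem r (freqs K w t)) *
      \prod_(r <- M) (1 - (1 - pn c n) ^+ count_mem r (freqs K w t)))).
Proof.
move=> tn; elim: M L => [|m M IH] L uL.
  transitivity (Expect c (fun w : Omega n => phi (freqs K w t) *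
     \prod_(r <- L) (~~ used w (freqs K w t) t r)%:R)).
    by apply: eq_bigr => w _; rewrite big_nil mulr1.
  rewrite Expect_unused //.
  by apply: eq_bigr => w _; rewrite big_nil mulr1.
have uL' : uniq (M ++ L) by move: uL; rewrite /= => /andP[].
(* The factor of m is 1 - x: subtract the statements for L and m :: L. *)
have umL : uniq (M ++ (m :: L)) by rewrite -cat1s uniq_catCA.
have := f_equal2 (fun x y : R => x - y) (IH _ uL') (IH _ umL).
rewrite -!Expect_sub => h.
transitivity (Expect c (fun w : Omega n => phi (freqs K w t) *
     ((\prod_(r <- L) (~~ used w (freqs K w t) t r)%:R) *
      \prod_(r <- M) (1 - (~~ used w (freqs K w t) t r)%:R)) - 
     phi (freqs K w t) *
     ((\prod_(r <- m :: L) (~~ used w (freqs K w t) t r)%:R) *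
      \prod_(r <- M) (1 - (~~ used w (freqs K w t) t r)%:R)))).
  by apply: eq_bigr => w _; rewrite !big_cons; congr (_ * _); ring.
by rewrite h; apply: eq_bigr => w _; rewrite !big_cons; congr (_ * _); ring.
Qed.

(** * Law of the smallest free frequency *)

Lemma newfreq_eq (K n : nat) (w : Omega n) (cs : seq nat) (t k : nat) :
  (1 <= k <= K)%N ->
  (newfreq K w cs t == k) = ~~ used w cs t k && all (used w cs t) (iota 1 k.-1).
Proof.
move=> /andP[k1 kK]; rewrite /newfreq.
have -> : iota 1 K = iota 1 k.-1 ++ k :: iota k.+1 (K - k).
  have -> : k :: iota k.+1 (K - k) = iota (1 + k.-1) (K - k).+1 by rewrite add1n prednK.
  by rewrite -iotaD; congr iota; lia.
rewrite filter_cat /=.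
case: (boolP (all _ (iota 1 k.-1))) => [/allP al|nal].
  rewrite (_ : [seq r <- iota 1 k.-1 | _] = [::]); last first.
    by apply/eqP; rewrite -[_ == _]negbK -has_filter; apply/hasPn => r /al ->.
  rewrite andbT /=; case: (boolP (used w cs t k)) => uk /=; last exact: eqxx.
  apply/negbTE/eqP => e.
  (* When [k] is used, the result is a larger frequency or the default 0, and [k] is neither since
     [1 <= k]. *)
  have : (nth 0%N [seq r <- iota k.+1 (K - k) | ~~ used w cs t r] 0 \in 0%N :: iota k.+1 (K - k)).
    case E : [seq r <- _ | _] => [|r s] /=; first by rewrite inE eqxx.
    have : r \in [seq r <- iota k.+1 (K - k) | ~~ used w cs t r] by rewrite E inE eqxx.
    by rewrite mem_filter inE => /andP[_ ->]; rewrite orbT.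
  by rewrite e inE mem_iota; lia.
rewrite andbF; apply/negbTE/eqP.
case E : [seq r <- iota 1 k.-1 | _] => [|r s] /=.
  move: nal; rewrite -has_predC has_filter (eq_filter (a2 := fun r => ~~ used w cs t r)) //.
  by rewrite E.
have : r \in [seq r <- iota 1 k.-1 | ~~ used w cs t r] by rewrite E inE eqxx.
by rewrite mem_filter mem_iota => /andP[_ ?] rk; lia.
Qed.

(** Probability that [k] is the smallest free frequency when each [r] is free independently with
    probability [y r]; [delta] is its value at [y r = expR (- (c * a r))]. *)
Definition qfree {R : realType} (k : nat) (y : nat -> R) : R :=
  y k * \prod_(1 <= r < k) (1 - y r).

(** The conditional law given the past in weak form: it is tested against every function [phi] of
    the frequency history. *)
Lemma Expect_newfreq {R : realType} (c : R) (K n t k : nat)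
    (phi : seq nat -> R) : (t < n)%N -> (1 <= k <= K)%N ->
  Expect c (fun w : Omega n => phi (freqs K w t) *
     (newfreq K w (freqs K w t) t == k)%:R) =
  Expect c (fun w : Omega n => phi (freqs K w t) *
     qfree k (fun r => (1 - pn c n) ^+ count_mem r (freqs K w t))).
Proof.
move=> tn kK; have k1 : (1 <= k)%N by case/andP: kK.
have uk : uniq (iota 1 k.-1 ++ [:: k]).
  by rewrite (_ : [:: k] = iota (1 + k.-1) 1) -?iotaD ?iota_uniq // add1n prednK.
have kE : iota 1 k.-1 = index_iota 1 k by rewrite /index_iota subn1.
have := Expect_used c K n t phi [:: k] (iota 1 k.-1) tn uk.
rewrite /qfree kE => h.
refine (etrans _ (etrans h _)); last by apply: eq_bigr => w _; rewrite big_seq1.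
apply: eq_bigr => w _; congr (_ * (_ * _)); rewrite big_seq1 newfreq_eq //.
rewrite -mulnb natrM kE; congr (_ * _).
elim: (index_iota 1 k) => [|r s IH] /=; rewrite ?big_nil ?big_cons // -mulnb natrM IH.
by congr (_ * _); case: used; rewrite ?subr0 ?subrr.
Qed.

(** * The integral equations *)

(** A general domain [T] lets this apply to the subspace topology of [[0, 1]]. *)
Lemma continuous_delta {R : realType} {T : topologicalType} (c : R) (k : nat)
    (a : nat -> T -> R) : (1 <= k)%N ->
  (forall r, (1 <= r <= k)%N -> continuous (a r)) ->
  continuous (fun t => delta c k (fun r => a r t)).
Proof.
move=> k1 ca.
have ce r : (1 <= r <= k)%N -> continuous (fun t => expR (- (c * a r t))).
  move=> rk t; apply: (@continuous_comp _ _ _ (fun t => - (c * a r t)) expR); last exact: continuous_expR.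
  by apply: cvgN; apply: cvgM; [exact: cvg_cst|exact: ca].
have cp s : all (fun r => 1 <= r <= k)%N s ->
    continuous (fun t => \prod_(r <- s) (1 - expR (- (c * a r t)))).
  elim: s => [|r s IH] /=.
    by move=> _ t; under eq_fun do rewrite big_nil; exact: cvg_cst.
  move=> /andP[rk sk] t; under eq_fun do rewrite big_cons.
  by apply: cvgM; [apply: cvgB; [exact: cvg_cst|exact: ce]|exact: IH].
move=> t; apply: cvgM; first by apply: ce; rewrite k1 /=.
by apply: cp; apply/allP => r; rewrite mem_index_iota => /andP[-> /ltnW].
Qed.

(** Differential form of [is_solution]. Derivatives are required only inside the interval, with
    continuity up to the endpoints, which is the form the mean value theorem needs. *)
Definition ivp {R : realType} (c : R) (K : nat) (a : nat -> R -> R) : Prop :=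
  forall k, (1 <= k <= K)%N ->
    [/\ {within `[0, 1], continuous (a k)}, a k 0 = 0 &
     forall t : R, t \in `]0, 1[ ->
       is_derive t 1 (a k) (delta c k (fun r => a r t))].

Lemma ivp_delta_continuous {R : realType} (c : R) (K : nat) (a : nat -> R -> R) (k : nat) :
  (forall k, (1 <= k <= K)%N -> {within `[0, 1], continuous (a k)}) ->
  (1 <= k <= K)%N ->
  {within `[0, 1], continuous (fun t => delta c k (fun r => a r t))}.
Proof.
move=> ca /andP[k1 kK]; have := @continuous_delta R (subspace (`[0, 1] : set R)) c k a k1; apply => r /andP[r1 rk].
by apply: ca; rewrite r1 (leq_trans rk).
Qed.

Lemma is_derive_Rintegral {R : realType} (f : R -> R) (a b x : R) :
  {within `[a, b], continuous f} -> x \in `]a, b[ ->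
  is_derive x 1 (fun x => (\int[@lebesgue_measure R]_(t in `[a, x]) f t)%R) (f x).
Proof.
move=> cf xab; have := xab; rewrite in_itv /= => /andP[ax xb].
have fi : (@lebesgue_measure R).-integrable `[a, b] (EFin \o f).
  by apply: continuous_compact_integrable => //; exact: segment_compact.
have cfx : {for x, continuous f}.
  exact: within_continuous_continuous (lt_trans ax xb) cf xab.
have [|d e] := continuous_FTC1 xb fi _ cfx; first by rewrite lte_fin.
by rewrite -e derive1E; exact: derivableP.
Qed.

Lemma ivp_of_solution {R : realType} (c : R) (K : nat) (a : nat -> R -> R) :
  is_solution c K a -> ivp c K a.
Proof.
move=> sol k kK; have [ca ea] := sol k kK; split => //.
  have /ea : (0 : R) \in `[0, 1] by rewrite in_itv /= lexx ler01.
  by rewrite set_itv1 integral_set1 => -[].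
move=> t t01.
have cd := ivp_delta_continuous c K a k (fun j jK => (sol j jK).1) kK.
(* The integral equation is known on [[0, 1]] only, hence in a neighbourhood of the interior point
   [t]. *)
apply: near_eq_is_derive (is_derive_Rintegral _ _ _ _ cd t01).
near=> s; have /ea : s \in `[0, 1].
  by apply: subset_itv_oo_cc; near: s; exact: near_in_itvoo.
by rewrite /Rintegral => <-.
Unshelve. all: by end_near. Qed.

Lemma solution_of_ivp {R : realType} (c : R) (K : nat) (a : nat -> R -> R) :
  ivp c K a -> is_solution c K a.
Proof.
move=> sol k kK; have [ca a0 da] := sol k kK; split => // t; rewrite in_itv /= => /andP[t0 t1].
have cd : {within `[0, 1], continuous (fun t => delta c k (fun r => a r t))}.
  by apply: (ivp_delta_continuous c K) => // j /sol[].
(* The fundamental theorem is applied on a nondegenerate interval, so [t = 0] is treated apart. *)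
move: t0; rewrite le_eqVlt => /predU1P[<-|t0].
  by rewrite set_itv1 integral_set1 a0.
have sub : `[0, t] `<=` `[0, 1] by apply: subset_itvl; rewrite bnd_simp.
have /(continuous_within_itvP _ t0)[_ a0t at1] := continuous_subspaceW sub ca.
have tin s : s \in `]0, t[ -> s \in `]0, 1[.
  by rewrite !in_itv /= => /andP[-> /lt_le_trans ->].
rewrite (@continuous_FTC2 _ _ (a k) 0 t) ?a0 ?sube0 //.
- exact: continuous_subspaceW cd.
- by split=> // s /tin h; case: (da s h).
- by move=> s /tin h; case: (da s h) => _ <-; rewrite derive1E.
Qed.

(** By strong induction on [k], the derivatives of [expR (c * a k t)] and [expR (c * b k t)]
    coincide, as they involve earlier components only. Both functions equal 1 at 0. *)
Lemma ivp_unique {R : realType} (c : R) (K : nat) (a b : nat -> R -> R) :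
  c != 0 -> ivp c K a -> ivp c K b ->
  forall k t, (1 <= k <= K)%N -> t \in `[0, 1] -> b k t = a k t.
Proof.
move=> c0 ia ib; elim/ltn_ind => k IH t kK; rewrite in_itv /= => /andP[t0 t1].
have [ca a0 da] := ia k kK; have [cb b0 db] := ib k kK.
pose H s := expR (c * b k s) - expR (c * a k s).
have cH : {within `[0, 1], continuous H}.
  by move=> s; apply: cvgB; apply: (@continuous_comp _ _ _ (fun t => c * _ k t) expR);
    try exact: continuous_expR; apply: cvgM; try exact: cvg_cst; [exact: cb|exact: ca].
have De (f : nat -> R -> R) (s : R) : is_derive s 1 (f k) (delta c k (fun r => f r s)) ->
    is_derive s 1 (fun s => expR (c * f k s)) (c * \prod_(1 <= r < k) (1 - expR (- (c * f r s)))).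
  move=> df; have dcf := is_deriveZ c df.
  have := @is_derive1_comp R expR (c \*: f k) s _ _ (is_derive_expR _) dcf.
  move=> h; apply: is_derive_eq h _.
  by rewrite /delta expRN /GRing.scale /=; field; rewrite gt_eqF ?expR_gt0.
have dH (s : R) : s \in `]0, t[ -> is_derive s 1 H 0.
  rewrite in_itv /= => /andP[s0 st]; have s01 : s \in `]0, 1[ by rewrite in_itv /= s0 (lt_le_trans st).
  apply: is_derive_eq (is_deriveB (De b s (db s s01)) (De a s (da s s01))) _.
  apply/eqP; rewrite subr_eq0; apply/eqP; congr (_ * _).
  apply: eq_big_nat => r /andP[r1 rk]; congr (1 - expR (- (c * _))).
  apply: IH => //; first by rewrite r1 (leq_trans (ltnW rk)) //; case/andP: kK.
  by rewrite in_itv /= !ltW // (lt_le_trans st).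
have sub : `[0, t] `<=` `[0, 1] by apply: subset_itvl; rewrite bnd_simp.
have [x _] := MVT_segment t0 dH (continuous_subspaceW sub cH).
rewrite mul0r /H a0 b0 subrr subr0 => /eqP; rewrite subr_eq0 => /eqP/expR_inj.
by move/(mulfI c0).
Qed.

Lemma delta_ext {R : realType} (c : R) (k : nat) (x y : nat -> R) : (1 <= k)%N ->
  (forall r, (1 <= r <= k)%N -> x r = y r) -> delta c k x = delta c k y.
Proof.
move=> k1 xy; rewrite /delta (xy k) ?k1 ?leqnn //; congr (_ * _).
by apply: eq_big_nat => r /andP[r1 rk]; rewrite xy // r1 ltnW.
Qed.

(** Components are added one by one in closed form. Nonnegativity is part of the induction because
    it gives [0 <= g], which keeps the argument of the logarithm at least 1. *)
Lemma ivp_exists {R : realType} (c : R) (K : nat) : 0 < c ->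
  exists2 a, ivp c K a &
    forall k t, (1 <= k <= K)%N -> t \in `[0, 1] -> 0 <= a k t.
Proof.
move=> c0; elim: K => [|K [a ia a_ge0]].
  by exists (fun _ _ => 0) => [k|k t]; case: k.
pose g t := \prod_(1 <= r < K.+1) (1 - expR (- (c * a r t))).
have cg : {within `[0, 1], continuous g}.
  (* With component [K.+1] set to zero, [g] becomes an instance of [delta], whose continuity is
     known. *)
  pose a' r := if r == K.+1 then fun=> 0 else a r.
  have -> : g = fun t => delta c K.+1 (fun r => a' r t).
    apply: funext => t; rewrite /delta /a' eqxx mulr0 oppr0 expR0 mul1r.
    by apply: eq_big_nat => r /andP[_ rK]; rewrite ltn_eqF.
  apply: (ivp_delta_continuous c K.+1) => [r /andP[r1]|]; last by rewrite /= leqnn.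
  rewrite leq_eqVlt /a'; case: eqP => [_ _ x|_ rK]; first exact: cvg_cst.
  by have [] := ia r _; first by rewrite r1.
have g0 t : t \in `[0, 1] -> 0 <= g t.
  move=> t01; rewrite /g big_nat_cond; apply: prodr_ge0 => r; rewrite andbT => rK.
  by rewrite subr_ge0 expR_le1 oppr_le0 mulr_ge0 ?(ltW c0) // a_ge0.
pose G (t : R) : R := \int[@lebesgue_measure R]_(s in `[0, t]) g s.
have G_ge0 t : t \in `[0, 1] -> 0 <= G t.
  rewrite in_itv /= => /andP[t0 t1]; apply: Rintegral_ge0 => s /=.
  rewrite in_itv /= => /andP[s0 st].
  by apply: g0; rewrite in_itv /= s0 (le_trans st).
have cG : {within `[0, 1], continuous G}.
  apply: parameterized_integral_continuous => //.
  by apply: continuous_compact_integrable => //; exact: segment_compact.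
(* A solves A' = exp (- c A) g, that is, (exp (c A))' = c g. *)
pose A t := c^-1 * ln (1 + c * G t).
have G1 t : t \in `[0, 1] -> 1 <= 1 + c * G t.
  by move=> t01; rewrite lerDl mulr_ge0 ?(ltW c0) ?G_ge0.
exists (fun r => if r == K.+1 then A else a r); last first.
  move=> k t /andP[k1]; rewrite leq_eqVlt; case: eqP => [_ _ t01|_ kK] /=.
    by rewrite mulr_ge0 ?invr_ge0 ?(ltW c0) ?ln_ge0 ?G1.
  by apply: a_ge0; rewrite k1.
move=> k /andP[k1]; rewrite leq_eqVlt; case: (eqVneq k K.+1) => [-> _|kn /= kK]; last first.
  have [cak ak0 dak] := ia k (introT andP (conj k1 kK)); split => // t t01.
  apply: is_derive_eq (dak t t01) _; apply: delta_ext => // r /andP[_ rk].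
  by rewrite ltn_eqF // (leq_ltn_trans rk).
split.
- apply/subspace_continuousP => x x01; apply: cvgM; first exact: cvg_cst.
  apply: continuous_cvg; first by apply: continuous_ln; apply: lt_le_trans (G1 x x01).
  apply: cvgD; first exact: cvg_cst.
  by apply: cvgM; [exact: cvg_cst|move/subspace_continuousP : cG; apply].
- by rewrite /A /G set_itv1 /Rintegral integral_set1 mulr0 addr0 ln1 mulr0.
move=> t t01; have t01' : t \in `[0, 1] by exact: subset_itv_oo_cc t01.
have pos : 0 < 1 + c * G t by apply: lt_le_trans (G1 t t01').
have dG := is_deriveD (is_derive_cst (1 : R) t 1) (is_deriveZ c (is_derive_Rintegral _ _ _ _ cg t01)).
have dA := is_deriveZ c^-1 (@is_derive1_comp R (@ln R) (cst 1 + c \*: G) t _ _ (is_derive1_ln pos) dG).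
apply: is_derive_eq dA _; rewrite /delta eqxx /A mulVKf ?gt_eqF // expRN lnK ?posrE //.
rewrite (_ : \prod_(_ <= _ < _) _ = g t); last first.
  by apply: eq_big_nat => r /andP[_ rK]; rewrite ltn_eqF.
rewrite /GRing.scale /= /GRing.scale /=; field.
by rewrite ?gt_eqF.
Qed.

(** * Mean-square deviation from the solution *)

Lemma pn_ge0 {R : realType} (c : R) (n : nat) : 0 <= c -> 0 <= pn c n.
Proof. by move=> c0; rewrite /pn le_min ler01 divr_ge0. Qed.

Lemma pn_eq {R : realType} (c : R) (n : nat) : 0 <= c -> c < n%:R ->
  pn c n = c / n%:R /\ c / n%:R < 1.
Proof.
move=> c0 cn; have n0 : 0 < n%:R :> R by apply: le_lt_trans cn.
have lt1 : c / n%:R < 1 by rewrite ltr_pdivrMr // mul1r.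
by split => //; rewrite /pn min_r // ltW.
Qed.

Lemma Prob_ge0 {R : realType} (c : R) (n : nat) (w : Omega n) :
  0 <= c -> 0 <= Prob c w.
Proof.
move=> c0; rewrite /Prob mulr_ge0 ?invr_ge0 //; case: ifP => // _.
by rewrite mulr_ge0 // exprn_ge0 ?pn_ge0 // subr_ge0 /pn ge_min lexx.
Qed.

Lemma le_Expect {R : realType} (c : R) (n : nat) (X Y : Omega n -> R) :
  0 <= c -> (forall w, X w <= Y w) -> Expect c X <= Expect c Y.
Proof. by move=> c0 XY; apply: ler_sum => w _; rewrite ler_wpM2l ?Prob_ge0. Qed.

Lemma Expect_add {R : realType} (c : R) (n : nat) (X Y : Omega n -> R) :
  Expect c (fun w => X w + Y w) = Expect c X + Expect c Y.
Proof. by rewrite /Expect -big_split; apply: eq_bigr => w _; rewrite mulrDr. Qed.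

Lemma Expect_mul {R : realType} (c : R) (n : nat) (x : R) (X : Omega n -> R) :
  Expect c (fun w => x * X w) = x * Expect c X.
Proof. by rewrite /Expect mulr_sumr; apply: eq_bigr => w _; rewrite mulrCA. Qed.

Lemma Expect_sum {R : realType} (c : R) (n : nat) {I : Type} (s : seq I)
    (X : I -> Omega n -> R) :
  Expect c (fun w => \sum_(i <- s) X i w) = \sum_(i <- s) Expect c (X i).
Proof.
by rewrite /Expect exchange_big; apply: eq_bigr => w _; rewrite mulr_sumr.
Qed.

Lemma Expect_cst {R : realType} (c : R) (n : nat) (x : R) :
  pn c n < 1 -> Expect c (fun _ : Omega n => x) = x.
Proof.
move=> p1; rewrite -[x]mulr1 Expect_mul; congr (_ * _).
have -> : Expect c (fun _ : Omega n => 1) = \sum_(sigma : {perm 'I_n}) n`!%:R^-1 *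
    \sum_E bern (pn c n) (pairs_lt n) E.
  under [RHS]eq_bigr do rewrite mulr_sumr.
  by rewrite pair_bigA; apply: eq_bigr => -[s E] _; rewrite mulr1.
by rewrite bern_sum1 // mulr1 sumr_const card_Sn -[LHS]mulr_natl divff //.
Qed.

(** * Lipschitz estimates for products and exponentials *)

Lemma prod_itv01 {R : realType} (s : seq nat) (u : nat -> R) :
  (forall r, r \in s -> 0 <= u r <= 1) -> 0 <= \prod_(r <- s) u r <= 1.
Proof.
move=> u01; rewrite !big_seq; apply/andP; split.
  by apply: prodr_ge0 => r /u01 /andP[].
by apply: prodr_ile1 => r /u01.
Qed.

(** Factors are exchanged one at a time; the others lie in [[0, 1]] and do not amplify the error. *)
Lemma prod_lipschitz {R : realType} (s : seq nat) (u v : nat -> R) :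
  (forall r, r \in s -> 0 <= u r <= 1) -> (forall r, r \in s -> 0 <= v r <= 1) ->
  `|\prod_(r <- s) u r - \prod_(r <- s) v r| <= \sum_(r <- s) `|u r - v r|.
Proof.
elim: s => [|r s IH] u01 v01; first by rewrite !big_nil subrr normr0.
have us x : x \in s -> 0 <= u x <= 1 by move=> xs; apply: u01; rewrite inE xs orbT.
have vs x : x \in s -> 0 <= v x <= 1 by move=> xs; apply: v01; rewrite inE xs orbT.
have /andP[P0 P1] := prod_itv01 s u us.
have /andP[v0 v1] := v01 r (mem_head _ _).
rewrite !big_cons; set P := \prod_(_ <- s) u _ in P0 P1 IH *.
set Q := \prod_(_ <- s) v _ in IH *.
rewrite (_ : u r * P - v r * Q = (u r - v r) * P + v r * (P - Q)); last by ring.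
apply: le_trans (ler_normD _ _) _; rewrite !normrM (ger0_norm P0) (ger0_norm v0).
apply: lerD; first by rewrite ler_piMr.
by apply: le_trans (IH us vs); rewrite ler_piMl.
Qed.

Lemma expr_lipschitz {R : realType} (x y : R) (m : nat) :
  0 <= x <= 1 -> 0 <= y <= 1 -> `|x ^+ m - y ^+ m| <= m%:R * `|x - y|.
Proof.
move=> x01 y01.
have := prod_lipschitz (index_iota 0 m) (fun=> x) (fun=> y) (fun _ _ => x01) (fun _ _ => y01).
by rewrite !prodr_const_nat sumr_const_nat subn0 mulr_natl.
Qed.

Lemma expRN_lipschitz {R : realType} (x y : R) : 0 <= x -> 0 <= y ->
  `|expR (- x) - expR (- y)| <= `|x - y|.
Proof.
wlog xy : x y / x <= y.
  move=> h x0 y0; case: (leP x y) => [|/ltW] xy; first exact: h.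
  by rewrite distrC (distrC x); exact: h.
move=> x0 _; rewrite ger0_norm; last by rewrite subr_ge0 ler_expR lerN2.
rewrite distrC ger0_norm ?subr_ge0 //.
rewrite (_ : - y = - x + - (y - x)); last by ring.
rewrite expRD -[X in X - _]mulr1 -mulrBr.
have := expR_ge1Dx (- (y - x)); have e1 : expR (- x) <= 1 by rewrite expR_le1 oppr_le0.
move=> h; apply: (@le_trans _ _ (1 - expR (- (y - x)))); last by lra.
by rewrite ler_piMl // subr_ge0 expR_le1 oppr_le0 subr_ge0.
Qed.

(** Follows from the chain [1 - p <= expR (- p) <= (1 + p)^-1 <= 1 - p + p ^+ 2]. *)
Lemma expRN_approx {R : realType} (p : R) : 0 <= p ->
  `|(1 - p) - expR (- p)| <= p ^+ 2.
Proof.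
move=> p0; have h1 := expR_ge1Dx (- p); have h2 := expR_ge1Dx p.
have h3 : expR (- p) <= (1 + p)^-1.
  by rewrite expRN lef_pV2 ?posrE ?expR_gt0 //; lra.
have h4 : (1 + p)^-1 <= 1 - p + p ^+ 2.
  rewrite -[_^-1]mul1r ler_pdivrMr; last by lra.
  rewrite (_ : _ * _ = 1 + p ^+ 3); last by ring.
  by rewrite lerDl exprn_ge0.
by rewrite distrC ger0_norm; lra.
Qed.

Lemma qfree_itv01 {R : realType} (k : nat) (y : nat -> R) : (1 <= k)%N ->
  (forall r, (1 <= r <= k)%N -> 0 <= y r <= 1) -> 0 <= qfree k y <= 1.
Proof.
move=> k1 y01; have /andP[y0 y1] : 0 <= y k <= 1 by apply: y01; rewrite k1 /=.
have /andP[P0 P1] : 0 <= \prod_(1 <= r < k) (1 - y r) <= 1.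
  apply: prod_itv01 => r; rewrite mem_index_iota => /andP[r1 rk].
  have : 0 <= y r <= 1 by apply: y01; rewrite r1 ltnW.
  by lra.
by rewrite /qfree mulr_ge0 // mulr_ile1.
Qed.

(** [qfree] is a single product of factors [y k] and [1 - y r], all in [[0, 1]], so [prod_lipschitz]
    applies. *)
Lemma qfree_lipschitz {R : realType} (k : nat) (y z : nat -> R) : (1 <= k)%N ->
  (forall r, (1 <= r <= k)%N -> 0 <= y r <= 1) ->
  (forall r, (1 <= r <= k)%N -> 0 <= z r <= 1) ->
  `|qfree k y - qfree k z| <= \sum_(1 <= r < k.+1) `|y r - z r|.
Proof.
move=> k1 y01 z01; pose f (y : nat -> R) r := if r == k then y r else 1 - y r.
have fE y' : qfree k y' = \prod_(1 <= r < k.+1) f y' r.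
  rewrite big_nat_recr //= mulrC /qfree /f eqxx; congr (_ * _).
  by apply: eq_big_nat => r /andP[_ rk]; rewrite ltn_eqF.
have f01 y' : (forall r, (1 <= r <= k)%N -> 0 <= y' r <= 1) ->
    forall r, r \in index_iota 1 k.+1 -> 0 <= f y' r <= 1.
  move=> y'01 r; rewrite mem_index_iota ltnS => /y'01; rewrite /f.
  by case: ifP => _ //; lra.
rewrite !fE; apply: le_trans (prod_lipschitz _ _ _ (f01 _ y01) (f01 _ z01)) _.
apply: ler_sum => r _; rewrite /f; case: ifP => _ //.
by rewrite (_ : _ - _ = z r - y r) 1?distrC //; ring.
Qed.

Lemma sumr_const1 {R : realType} (m : nat) (x : R) :
  \sum_(1 <= r < m.+1) x = m%:R * x.
Proof. by rewrite sumr_const_nat subn1 mulr_natl. Qed.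

Lemma delta_lipschitz {R : realType} (c : R) (k : nat) (x y : nat -> R) :
  0 <= c -> (1 <= k)%N ->
  (forall r, (1 <= r <= k)%N -> 0 <= x r) -> (forall r, (1 <= r <= k)%N -> 0 <= y r) ->
  `|delta c k x - delta c k y| <= c * \sum_(1 <= r < k.+1) `|x r - y r|.
Proof.
move=> c0 k1 x0 y0.
have e01 z : 0 <= z -> 0 <= expR (- (c * z)) <= 1.
  by move=> z0; rewrite expR_ge0 expR_le1 oppr_le0 mulr_ge0.
apply: le_trans (qfree_lipschitz k (fun r => expR (- (c * x r)))
  (fun r => expR (- (c * y r))) k1 (fun r rk => e01 _ (x0 r rk)) (fun r rk => e01 _ (y0 r rk))) _.
rewrite mulr_sumr !big_nat; apply: ler_sum => r; rewrite ltnS => rk.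
apply: le_trans (expRN_lipschitz _ _ _ _) _; rewrite ?mulr_ge0 ?x0 ?y0 //.
by rewrite -mulrBr normrM ger0_norm.
Qed.

Lemma delta_itv01 {R : realType} (c : R) (k : nat) (x : nat -> R) :
  0 <= c -> (1 <= k)%N -> (forall r, (1 <= r <= k)%N -> 0 <= x r) ->
  0 <= delta c k x <= 1.
Proof.
move=> c0 k1 x0; apply: (qfree_itv01 k (fun r => expR (- (c * x r))) k1) => r rk.
by rewrite expR_ge0 expR_le1 oppr_le0 mulr_ge0 // x0.
Qed.

(** * Regularity of the solution *)

Section Solution.
Context {R : realType} (c : R) (K : nat) (a : nat -> R -> R).
Hypotheses (c0 : 0 < c) (ia : ivp c K a).
Hypothesis a_ge0 : forall k t, (1 <= k <= K)%N -> t \in `[0, 1] -> 0 <= a k t.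

Lemma solution_mvt (k : nat) (u v : R) : (1 <= k <= K)%N -> 0 <= u -> u <= v -> v <= 1 ->
  exists2 x, x \in `[u, v] & a k v - a k u = delta c k (fun r => a r x) * (v - u).
Proof.
move=> kK u0 uv v1; have [ca _ da] := ia k kK.
have dak x : x \in `]u, v[ -> is_derive x 1 (a k) (delta c k (fun r => a r x)).
  rewrite in_itv /= => /andP[ux xv]; apply: da.
  by rewrite in_itv /= (le_lt_trans u0) // (lt_le_trans xv).
have cak : {within `[u, v], continuous (a k)}.
  apply: continuous_subspaceW ca => x /=; rewrite !in_itv /= => /andP[ux xv].
  by rewrite (le_trans u0) // (le_trans xv).
have [x xuv e] := MVT_segment uv dak cak.
by exists x.
Qed.

Lemma solution_ge0 (k r : nat) (t : R) : (1 <= k <= K)%N -> t \in `[0, 1] ->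
  (1 <= r <= k)%N -> 0 <= a r t.
Proof.
by move=> /andP[_ kK] t01 /andP[r1 rk]; apply: a_ge0; rewrite // r1 (leq_trans rk).
Qed.

Lemma solution_incr (k : nat) (u v : R) : (1 <= k <= K)%N -> 0 <= u -> u <= v -> v <= 1 ->
  0 <= a k v - a k u <= v - u.
Proof.
move=> kK u0 uv v1; have [x xuv ->] := solution_mvt k u v kK u0 uv v1.
have x01 : x \in `[0, 1].
  by move: xuv; rewrite !in_itv /= => /andP[ux xv]; rewrite (le_trans u0) // (le_trans xv).
have /andP[d0 d1] := delta_itv01 c k (fun r => a r x) (ltW c0) (proj1 (andP kK))
  (fun r => solution_ge0 k r x kK x01).
by rewrite mulr_ge0 ?subr_ge0 // ler_piMl // subr_ge0.
Qed.

(** The mean value theorem evaluates [delta] at some [x] in place of [u]. Each of at most [K]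
    components moves by at most [v - u] in between, and [delta_lipschitz] supplies the factor
    [c]. *)
Lemma solution_linearize (k : nat) (u v : R) : (1 <= k <= K)%N -> 0 <= u -> u <= v -> v <= 1 ->
  `|a k v - a k u - delta c k (fun r => a r u) * (v - u)| <= c * K%:R * (v - u) ^+ 2.
Proof.
move=> kK u0 uv v1; have [x xuv ->] := solution_mvt k u v kK u0 uv v1.
have u01 : u \in `[0, 1] by rewrite in_itv /= u0 (le_trans uv).
move: xuv; rewrite in_itv /= => /andP[ux xv].
have x01 : x \in `[0, 1] by rewrite in_itv /= (le_trans u0) // (le_trans xv).
have k1 : (1 <= k)%N by case/andP: kK.
rewrite -mulrBl normrM (ger0_norm (_ : 0 <= v - u)) ?subr_ge0 // exprS expr1 mulrA.
rewrite ler_wpM2r ?subr_ge0 //.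
apply: le_trans (delta_lipschitz _ _ _ _ (ltW c0) k1 (fun r => solution_ge0 k r x kK x01)
  (fun r => solution_ge0 k r u kK u01)) _.
rewrite -mulrA ler_wpM2l ?(ltW c0) //.
apply: (@le_trans _ _ (\sum_(1 <= r < k.+1) (v - u))).
  rewrite !big_nat; apply: ler_sum => r /andP[r1]; rewrite ltnS => rk.
  have rK : (1 <= r <= K)%N by rewrite r1 (leq_trans rk) //; case/andP: kK.
  have /andP[h1 h2] := solution_incr r u x rK u0 ux (le_trans xv v1).
  by rewrite ger0_norm // (le_trans h2) // lerD2r.
rewrite sumr_const1 ler_wpM2r ?subr_ge0 //.
by rewrite ler_nat; case/andP: kK.
Qed.

(** * One-step recursion for the mean-square deviation *)

Definition dev (n : nat) (w : Omega n) (k t : nat) : R :=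
  (Acount K w k t)%:R / n%:R - a k (t%:R / n%:R).

Definition sqdev (n : nat) (w : Omega n) (t : nat) : R :=
  \sum_(1 <= k < K.+1) dev n w k t ^+ 2.

Lemma Acount_leq (n : nat) (w : Omega n) (k t : nat) : (Acount K w k t <= t)%N.
Proof. by rewrite /Acount -[X in (_ <= X)%N](size_freqs K n w t) count_size. Qed.

Lemma AcountS (n : nat) (w : Omega n) (k t : nat) :
  Acount K w k t.+1 = (Acount K w k t + (newfreq K w (freqs K w t) t == k))%N.
Proof. by rewrite /Acount /= -cats1 count_cat /= addn0. Qed.

(* Conditional probability that the vertex explored at step t+1 gets frequency k. *)
Definition qprob (n : nat) (w : Omega n) (k t : nat) : R :=
  qfree k (fun r => (1 - pn c n) ^+ Acount K w r t).

(** Two errors per frequency: replacing [1 - c / n] by [expR (- (c / n))] in a power of order at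
    most [n] costs [c ^+ 2 / n], and replacing [A / n] by the solution costs [c] times the
    deviation. *)
Lemma qprob_approx (n : nat) (w : Omega n) (k t : nat) : c < n%:R ->
  (1 <= k <= K)%N -> (t <= n)%N ->
  `|qprob n w k t - delta c k (fun r => a r (t%:R / n%:R))| <=
  K%:R * c ^+ 2 / n%:R + c * \sum_(1 <= r < K.+1) `|dev n w r t|.
Proof.
move=> cn kK tn; have [pE p1] := pn_eq c n (ltW c0) cn.
have n0 : 0 < n%:R :> R by apply: lt_trans cn.
have p0 : 0 <= c / n%:R by rewrite divr_ge0 // ltW.
have t01 : (t%:R / n%:R : R) \in `[0, 1].
  by rewrite in_itv /= divr_ge0 //= ler_pdivrMr // mul1r ler_nat.
have k1 : (1 <= k)%N by case/andP: kK.
have q01 : 0 <= 1 - c / n%:R <= 1 by lra.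
have e01 (x : R) : 0 <= x -> 0 <= expR (- x) <= 1.
  by move=> x0; rewrite expR_ge0 expR_le1 oppr_le0.
rewrite /qprob pE.
apply: le_trans (qfree_lipschitz k _ (fun r => expR (- (c * a r (t%:R / n%:R)))) k1 _ _) _.
- by move=> r _; rewrite exprn_ge0 ?exprn_ile1 //; lra.
- by move=> r rk; rewrite e01 // mulr_ge0 ?(ltW c0) // (solution_ge0 k).
apply: (@le_trans _ _ (\sum_(1 <= r < K.+1) (c ^+ 2 / n%:R + c * `|dev n w r t|))); last first.
  by rewrite big_split /= mulr_sumr sumr_const1 mulrA.
rewrite [X in _ <= X](big_cat_nat (n := k.+1)) //=; last by rewrite ltnS; case/andP: kK.
rewrite -[X in X <= _]addr0; apply: lerD; last first.
  by apply: sumr_ge0 => r _; rewrite addr_ge0 ?divr_ge0 ?sqr_ge0 // mulr_ge0 // ltW.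
rewrite !big_nat; apply: ler_sum => r /andP[r1]; rewrite ltnS => rk.
have r01 : 0 <= a r (t%:R / n%:R) by apply: (solution_ge0 k); rewrite // r1.
set A := Acount K w r t.
have An : (A <= n)%N by apply: leq_trans (Acount_leq _ _ _ _) tn.
apply: (le_trans (ler_distD (expR (- (c / n%:R)) ^+ A) _ _)); apply: lerD.
  have h := expr_lipschitz _ _ A q01 (e01 _ p0). apply: le_trans h _.
  apply: (@le_trans _ _ (n%:R * (c / n%:R) ^+ 2)).
    by apply: ler_pM => //; rewrite ?ler_nat // expRN_approx.
  by rewrite le_eqVlt; apply/orP; left; apply/eqP; field; rewrite gt_eqF.
rewrite -expRM_natl.
rewrite (_ : A%:R * - (c / n%:R) = - (c * (A%:R / n%:R))); last by ring.
apply: le_trans (expRN_lipschitz _ _ _ _) _; rewrite ?mulr_ge0 ?divr_ge0 ?(ltW c0) //.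
by rewrite -mulrBr normrM (ger0_norm (ltW c0)).
Qed.

(** The deviation [x] changes by [(I - m) / n], with [I] the indicator of frequency [k] and [m / n]
    the increment of the solution. In the square, the cross term splits into the noise [I - q], kept
    as the last summand, and the drift error [q - m]. The constant [D] adds the errors of
    [qprob_approx] and [solution_linearize]. *)
Lemma dev_step (n : nat) (w : Omega n) (k t : nat) (D := K%:R * c ^+ 2 + c * K%:R) :
  c < n%:R -> (1 <= k <= K)%N -> (t < n)%N ->
  dev n w k t.+1 ^+ 2 <= dev n w k t ^+ 2
    + n%:R^-1 * (c * (K%:R * dev n w k t ^+ 2 + sqdev n w t)
                 + D * dev n w k t ^+ 2) + (D + 1) * n%:R^-1 ^+ 2
    + 2 / n%:R * (dev n w k t *
        ((newfreq K w (freqs K w t) t == k)%:R - qprob n w k t)).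
Proof.
move=> cn kK tn; have n0 : 0 < n%:R :> R by apply: lt_trans cn.
have n1 : 1 <= n%:R :> R by rewrite -[1]/(1%:R) ler_nat (leq_ltn_trans _ tn).
have h1 := qprob_approx n w k t cn kK (ltnW tn).
set I := (_ == k)%:R; set q := qprob n w k t in h1 *; set x := dev n w k t.
set i := n%:R^-1; have i0 : 0 < i by rewrite invr_gt0.
have i1 : i <= 1 by rewrite invf_le1.
set u := t%:R / n%:R in h1; pose v : R := t.+1%:R / n%:R.
have vu : v - u = i by rewrite /v /u -mulrBl -natrB // subSnn mul1r.
have u0 : 0 <= u by rewrite divr_ge0.
have uv : u <= v by rewrite -subr_ge0 vu ltW.
have v1 : v <= 1 by rewrite ler_pdivrMr // mul1r ler_nat.
have := solution_incr k u v kK u0 uv v1; have := solution_linearize k u v kK u0 uv v1.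
rewrite vu; set d := a k v - a k u; set del := delta _ _ _ in h1 *.
move=> h2 /andP[d0 d1]; set m := n%:R * d.
have ni : n%:R * i = 1 by rewrite mulfV // gt_eqF.
have di : d = m * i by rewrite /m mulrAC ni mul1r.
have m01 : 0 <= m <= 1.
  by rewrite /m mulr_ge0 //= -[X in _ <= X]ni ler_wpM2l.
have h3 : `|m - del| <= c * K%:R * i.
  have -> : m - del = n%:R * (d - del * i).
    by rewrite mulrBr mulrCA ni mulr1.
  rewrite normrM gtr0_norm //; apply: (@le_trans _ _ (n%:R * (c * K%:R * i ^+ 2))).
    by rewrite ler_wpM2l.
  have -> : n%:R * (c * K%:R * i ^+ 2) = (n%:R * i) * (c * K%:R * i) by ring.
  by rewrite ni mul1r.
have xS : dev n w k t.+1 = x + (I - m) * i.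
  by rewrite /dev AcountS natrD -/I mulrDl -/v mulrBl -di /x /dev -/u /d -/i; ring.
set S1 := \sum_(1 <= r < K.+1) `|dev n w r t| in h1.
have qm : `|q - m| <= D * i + c * S1.
  apply: le_trans (ler_distD del _ _) _; rewrite [`|del - m|]distrC.
  by apply: le_trans (lerD h1 h3) _; rewrite /D -/i; lra.
(* Termwise [2 * a * b <= a ^+ 2 + b ^+ 2] turns the first-order error into squared deviations. *)
have xS1 : 2 * `|x| * S1 <= K%:R * x ^+ 2 + sqdev n w t.
  rewrite /S1 /sqdev mulr_sumr.
  have -> : K%:R * x ^+ 2 = \sum_(1 <= r < K.+1) x ^+ 2.
    by rewrite sumr_const1.
  rewrite -big_split /=; apply: ler_sum => r _.
  rewrite -[x ^+ 2]real_normK ?num_real // -[dev n w r t ^+ 2]real_normK ?num_real //.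
  have := sqr_ge0 (`|x| - `|dev n w r t|); lra.
have D0 : 0 <= D by rewrite addr_ge0 // mulr_ge0 ?sqr_ge0 // ltW.
have x2 : 2 * `|x| <= 1 + x ^+ 2.
  rewrite -[x ^+ 2]real_normK ?num_real //; have := sqr_ge0 (1 - `|x|); lra.
have main : 2 * (x * (q - m)) <= c * (K%:R * x ^+ 2 + sqdev n w t) + D * x ^+ 2 + D * i.
  apply: (@le_trans _ _ (2 * `|x| * (D * i + c * S1))).
    apply: le_trans (ler_norm _) _; rewrite !normrM normr_nat -mulrA.
    by rewrite !ler_wpM2l.
  rewrite mulrDr [X in _ + X](_ : _ = c * (2 * `|x| * S1)); last by ring.
  have := ler_wpM2l (ltW c0) xS1; have := ler_wpM2r (mulr_ge0 D0 (ltW i0)) x2.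
  have : D * i * x ^+ 2 <= D * x ^+ 2.
    by rewrite ler_wpM2r ?sqr_ge0 // ler_piMr.
  lra.
have Im : (I - m) ^+ 2 <= 1.
  have I01 : 0 <= I <= 1 by rewrite /I; case: eqP => _; rewrite ?lexx ?ler01.
  by rewrite -real_normK ?num_real // expr_le1 // ler_norml; lra.
rewrite xS sqrrD -/x.
have := ler_wpM2l (ltW i0) main; have := ler_wpM2r (sqr_ge0 i) Im.
rewrite exprMn; lra.
Qed.

(** Summing [dev_step] over [k] yields the coefficient [2 * c * K + D] of [sqdev / n] and the source
    [K * (D + 1) / n ^+ 2]; this one constant dominates both. *)
Definition rate : R := 2 * c * K%:R + (K%:R * c ^+ 2 + c * K%:R) * (1 + K%:R) + K%:R.

(** The deviation at step [t] is a function of the history, hence an admissible [phi] in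
    [Expect_newfreq]. *)
Lemma Expect_martingale_step (n k t : nat) : (1 <= k <= K)%N -> (t < n)%N ->
  Expect c (fun w : Omega n => dev n w k t *
    ((newfreq K w (freqs K w t) t == k)%:R - qprob n w k t)) = 0.
Proof.
move=> kK tn.
pose phi (cs : seq nat) : R := (count_mem k cs)%:R / n%:R - a k (t%:R / n%:R).
have := Expect_newfreq c K n t k phi tn kK => h.
transitivity (Expect c (fun w : Omega n =>
  phi (freqs K w t) * (newfreq K w (freqs K w t) t == k)%:R -
  phi (freqs K w t) *
     qfree k (fun r => (1 - pn c n) ^+ count_mem r (freqs K w t)))).
  by apply: eq_bigr => w _; rewrite -mulrBr.
by rewrite Expect_sub h subrr.
Qed.

Lemma Expect_sqdev_step (n t : nat) : c < n%:R -> (t < n)%N ->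
  Expect c (fun w : Omega n => sqdev n w t.+1) <=
  (1 + rate / n%:R) * Expect c (fun w : Omega n => sqdev n w t) +
  rate * n%:R^-1 ^+ 2.
Proof.
move=> cn tn; have n0 : 0 < n%:R :> R by apply: lt_trans cn.
have [pE p1] := pn_eq c n (ltW c0) cn.
pose Z n w k := dev n w k t * ((newfreq K w (freqs K w t) t == k)%:R - qprob n w k t).
apply: (@le_trans _ _ (Expect c (fun w : Omega n =>
   ((1 + rate / n%:R) * sqdev n w t + rate * n%:R^-1 ^+ 2)
   + 2 / n%:R * \sum_(1 <= k < K.+1) Z n w k))).
  apply: le_Expect (ltW c0) _ => w.
  rewrite {1}/sqdev big_nat.
  apply: le_trans (ler_sum _ (fun k kK => dev_step n w k t cn kK tn)) _.
  rewrite -big_nat !big_split /= -!mulr_sumr !big_split /= -!mulr_sumr big_split /= -!mulr_sumr.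
  rewrite -/(sqdev n w t) !sumr_const1 -/(Z n w).
  rewrite lerD2r.
  set i := n%:R^-1; have i0 : 0 < i by rewrite invr_gt0.
  set S := sqdev n w t; have S0 : 0 <= S by apply: sumr_ge0 => *; rewrite sqr_ge0.
  set D := _ + c * K%:R; have D0 : 0 <= D by rewrite addr_ge0 // mulr_ge0 ?sqr_ge0 // ltW.
  have K0 : 0 <= K%:R :> R by [].
  have h1 : 0 <= D * K%:R * i * S by rewrite !mulr_ge0 // ltW.
  have h2 : 0 <= K%:R * i * S by rewrite !mulr_ge0 // ltW.
  have h3 : 0 <= c * K%:R * i ^+ 2 by rewrite !mulr_ge0 ?sqr_ge0 // ltW.
  have h4 : 0 <= D * i ^+ 2 by rewrite !mulr_ge0 ?sqr_ge0 // ltW.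
  rewrite /rate -/D; lra.
have EZ : Expect c (fun w : Omega n => \sum_(1 <= k < K.+1) Z n w k) = 0.
  rewrite Expect_sum big_nat big1 // => k kK.
  exact: Expect_martingale_step.
by rewrite !Expect_add !Expect_mul EZ Expect_cst ?pE // mulr0 addr0.
Qed.

Lemma Expect_sqdev (n t : nat) : c < n%:R -> (t <= n)%N ->
  Expect c (fun w : Omega n => sqdev n w t) <= expR rate / n%:R.
Proof.
move=> cn tn; have n0 : 0 < n%:R :> R by apply: lt_trans cn.
have [pE p1] := pn_eq c n (ltW c0) cn.
have r0 : 0 <= rate.
  by rewrite /rate !addr_ge0 ?mulr_ge0 ?addr_ge0 ?mulr_ge0 ?sqr_ge0 // ltW.
set i := n%:R^-1; have i0 : 0 < i by rewrite invr_gt0.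
have q0 : 0 <= 1 + rate * i by rewrite addr_ge0 // mulr_ge0 // ltW.
(* Discrete Gronwall: adding [i] absorbs the source term [rate * i ^+ 2] and makes the recursion
   purely multiplicative. *)
have h : Expect c (fun w : Omega n => sqdev n w t) + i <= (1 + rate * i) ^+ t * i.
  elim: t tn => [|t IH] tn.
    rewrite expr0 mul1r -[X in _ <= X]add0r lerD2r.
    rewrite /Expect big1 // => w _; rewrite /sqdev big_nat big1 ?mulr0 // => k kK.
    by have [_ ak0 _] := ia k kK; rewrite /dev /Acount /= !mul0r ak0 subrr expr0n.
  have := Expect_sqdev_step n t cn tn; have := ler_wpM2l q0 (IH (ltnW tn)).
  rewrite -/i (exprS _ t); lra.
apply: (@le_trans _ _ ((1 + rate * i) ^+ t * i)); first by apply: le_trans h; rewrite lerDl ltW.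
rewrite ler_wpM2r ?(ltW i0) //.
apply: (@le_trans _ _ (expR (rate * i) ^+ t)).
  by rewrite lerXn2r ?nnegrE ?expR_ge0 // expR_ge1Dx.
rewrite -expRM_natl ler_expR.
rewrite mulrCA ler_piMr // ler_pdivrMr // mul1r ler_nat //.
Qed.

(** * From grid points to uniform convergence *)

Lemma Acount_lipschitz (n : nat) (w : Omega n) (k s t : nat) : (s <= t)%N ->
  (Acount K w k s <= Acount K w k t <= Acount K w k s + (t - s))%N.
Proof.
move=> st; rewrite -(subnKC st); elim: (t - s)%N => [|i IH].
  by rewrite addn0 subnn addn0 leqnn.
by rewrite addnS AcountS; case: eqP => _; lia.
Qed.

(** Both terms of [dev] are nondecreasing with increments at most [(t - s) / n], so their difference
    moves no more than one of them could. *)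
Lemma dev_lipschitz (n : nat) (w : Omega n) (k s t : nat) : (1 <= k <= K)%N ->
  (0 < n)%N -> (s <= t)%N -> (t <= n)%N ->
  `|dev n w k t - dev n w k s| <= (t - s)%:R / n%:R.
Proof.
move=> kK n0 st tn; have n0' : 0 < n%:R :> R by rewrite ltr0n.
have /andP[A1 A2] := Acount_lipschitz n w k s t st.
have st' : s%:R / n%:R <= t%:R / n%:R :> R by rewrite ler_pM2r ?invr_gt0 // ler_nat.
have t1 : t%:R / n%:R <= 1 :> R by rewrite ler_pdivrMr // mul1r ler_nat.
have s0 : 0 <= s%:R / n%:R :> R by rewrite divr_ge0.
have /andP[a1 a2] := solution_incr k _ _ kK s0 st' t1.
have d1 : 0 <= ((Acount K w k t)%:R - (Acount K w k s)%:R) / n%:R :> R.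
  by rewrite divr_ge0 // subr_ge0 ler_nat.
have d2 : ((Acount K w k t)%:R - (Acount K w k s)%:R) / n%:R <= (t - s)%:R / n%:R :> R.
  by rewrite ler_pM2r ?invr_gt0 // lerBlDl -natrD ler_nat.
rewrite -mulrBl -natrB // in a2.
rewrite mulrBl in d1 d2.
by rewrite /dev ler_norml; lra.
Qed.

(** The mesh is [n %/ m]. For [m <= n] the rounding gives [n < 2 * m * (n %/ m)], so indices up to
    [2 * m] cover all times; [minn] caps the points beyond [n]. *)
Definition grid_sqdev (m n : nat) (w : Omega n) : R :=
  \sum_(0 <= j < (2 * m).+1) sqdev n w (minn (j * (n %/ m)) n).

Lemma Expect_grid_sqdev (m n : nat) : c < n%:R ->
  Expect c (grid_sqdev m n) <= (2 * m).+1%:R * (expR rate / n%:R).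
Proof.
move=> cn; rewrite /grid_sqdev Expect_sum.
apply: (@le_trans _ _ (\sum_(0 <= j < (2 * m).+1) expR rate / n%:R)).
  by apply: ler_sum => j _; apply: Expect_sqdev; rewrite // geq_minr.
by rewrite sumr_const_nat subn0 mulr_natl.
Qed.

Lemma sqdev_ge0 (n : nat) (w : Omega n) (t : nat) : 0 <= sqdev n w t.
Proof. by apply: sumr_ge0 => *; rewrite sqr_ge0. Qed.

(** The error budget is [d / 2] at a grid point, [d / 4] for moving from it to the current step, and
    [d / 4] for rounding time to a multiple of [1 / n]. *)
Lemma alpha_n_close (m n : nat) (w : Omega n) (d : R) : 0 < d ->
  (0 < m)%N -> (m <= n)%N -> 4 / d <= m%:R -> grid_sqdev m n w < (d / 2) ^+ 2 ->
  forall k t, (1 <= k <= K)%N -> t \in `[0, 1] -> `|a k t - alpha_n K w k t| < d.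
Proof.
move=> d0 m0 mn dm small k t kK; rewrite in_itv /= => /andP[t0 t1].
have n0 : (0 < n)%N by apply: leq_trans mn.
have n0' : 0 < n%:R :> R by rewrite ltr0n.
have m0' : 0 < m%:R :> R by rewrite ltr0n.
set L := (n %/ m)%N; have L0 : (0 < L)%N by rewrite divn_gt0.
have nt0 : 0 <= n%:R * t by rewrite mulr_ge0.
have /andP[s1 s2] := truncn_itv nt0; set s := Num.truncn (n%:R * t) in s1 s2.
have sn : (s <= n)%N.
  by rewrite -(ler_nat R) (le_trans s1) // ler_piMr.
(* The last grid point not after [s]. *)
set s' := ((s %/ L) * L)%N; have s's : (s' <= s)%N by exact: leq_trunc_div.
have jm : (s %/ L < (2 * m).+1)%N.
  rewrite ltnS (leq_trans (leq_div2r L sn)) // -ltnS ltn_divLR //.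
  by have := ltn_ceil n m0; rewrite -/L; nia.
have ssL : (s - s' <= L)%N.
  by rewrite /s' {1}(divn_eq s L) addKn ltnW // ltn_mod.
have h1 : `|dev n w k s'| < d / 2.
  rewrite -(@ltr_pXn2r _ 2) // ?nnegrE ?divr_ge0 ?(ltW d0) // real_normK ?num_real //.
  apply: le_lt_trans small; apply: (@le_trans _ _ (sqdev n w s')).
    rewrite /sqdev (bigD1_seq k) ?iota_uniq ?mem_index_iota ?ltnS //=.
    by rewrite lerDl sumr_ge0 // => *; rewrite sqr_ge0.
  rewrite /grid_sqdev (bigD1_seq (s %/ L)%N) ?iota_uniq ?mem_index_iota //=.
  rewrite -/L (minn_idPl _); last exact: leq_trans s's sn.
  by rewrite lerDl sumr_ge0 // => *; rewrite sqdev_ge0.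
have h2 := dev_lipschitz n w k s' s kK n0 s's sn.
have im : m%:R^-1 <= d / 4.
  by rewrite -[d / 4]invrK lef_pV2 ?posrE ?invr_gt0 ?divr_gt0 // invf_div.
have h3 : (s - s')%:R / n%:R <= m%:R^-1 :> R.
  rewrite ler_pdivrMr // mulrC ler_pdivlMr // -natrM ler_nat.
  by apply: leq_trans (leq_trunc_div n m); rewrite leq_mul2r ssL orbT.
have st : s%:R / n%:R <= t by rewrite ler_pdivrMr // mulrC.
have s0 : 0 <= s%:R / n%:R :> R by rewrite divr_ge0.
have /andP[a1 a2] := solution_incr k _ _ kK s0 st t1.
have h4 : t - s%:R / n%:R <= m%:R^-1.
  apply: (@le_trans _ _ n%:R^-1); last by rewrite lef_pV2 ?posrE // ler_nat.
  have : t < s.+1%:R / n%:R by rewrite ltr_pdivlMr // mulrC.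
  by rewrite -natr1 mulrDl mul1r; lra.
rewrite /alpha_n -/s.
have -> : a k t - (Acount K w k s)%:R / n%:R =
    (a k t - a k (s%:R / n%:R)) - (dev n w k s - dev n w k s') - dev n w k s'.
  by rewrite /dev; ring.
move: h1 h2; rewrite ler_norml !ltr_norml; lra.
Qed.

(** A pointwise form of the Markov inequality: either the grid deviation is small and continuity of
    [F] at [a] applies, or the bound [2 * M] is dominated by a multiple of [grid_sqdev]. *)
Lemma solution_cvg_dist : proc_cvg_dist c K a.
Proof.
move=> F [[M FM] Fcont]; apply/cvgrPdist_lt => eps eps0.
have [d d0 Fd] := Fcont a (eps / 2) (divr_gt0 eps0 (ltr0Sn R 1)).
have M0 : 0 <= M by apply: le_trans (FM a).
pose m := (Num.truncn (4 / d)).+1.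
have dm : 4 / d <= m%:R by rewrite ltW // truncnS_gt.
(* Chosen so that [B * (d / 2) ^+ 2 = 2 * M]. Neither [B] nor [m] depends on [n]. *)
pose B := 2 * M * (2 / d) ^+ 2.
have B0 : 0 <= B by apply: mulr_ge0; [rewrite mulr_ge0|exact: sqr_ge0].
near=> n.
have cn : c < n%:R by near: n; exact: nbhs_infty_gtr.
have mn : (m <= n)%N by near: n; exact: nbhs_infty_ge.
have Bn : 2 * (B * (2 * m).+1%:R * expR rate) / eps < n%:R by near: n; exact: nbhs_infty_gtr.
have n0 : 0 < n%:R :> R by apply: lt_trans cn.
have [pE p1] := pn_eq c n (ltW c0) cn.
pose al (w : Omega n) := (fun k t => alpha_n K w k t) : nat -> R -> R.
have close w : `|F a - F (al w)| <= eps / 2 + B * grid_sqdev m n w.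
  have G0 : 0 <= grid_sqdev m n w by apply: sumr_ge0 => *; rewrite sqdev_ge0.
  have [small|big] := ltP (grid_sqdev m n w) ((d / 2) ^+ 2).
    have := Fd (al w) (alpha_n_close m n w d d0 (ltn0Sn _) mn dm small).
    by move=> /ltW h; apply: (le_trans h); rewrite lerDl mulr_ge0.
  apply: (@le_trans _ _ (2 * M)).
    by apply: le_trans (ler_normB _ _) _; rewrite mulr2n mulrDl !mul1r lerD.
  apply: (@le_trans _ _ (B * (d / 2) ^+ 2)).
    have e : 2 / d * (d / 2) = 1 by field; rewrite gt_eqF.
    by rewrite /B -mulrA -exprMn e expr1n mulr1.
  by rewrite -[X in X <= _]add0r lerD ?divr_ge0 ?(ltW eps0) // ler_wpM2l.
have -> : F a - Expect c (fun w : Omega n => F (al w)) =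
    Expect c (fun w : Omega n => F a - F (al w)).
  by rewrite Expect_sub Expect_cst ?pE.
apply: (@le_lt_trans _ _ (Expect c (fun w : Omega n => eps / 2 + B * grid_sqdev m n w))).
  apply: le_trans (ler_norm_sum _ _ _) _; apply: ler_sum => w _.
  by rewrite normrM (ger0_norm (Prob_ge0 _ _ _ (ltW c0))) ler_wpM2l ?Prob_ge0 ?(ltW c0).
rewrite Expect_add Expect_cst ?pE // Expect_mul.
have h : B * Expect c (grid_sqdev m n) < eps / 2.
  apply: (le_lt_trans (ler_wpM2l B0 (Expect_grid_sqdev m n cn))).
  rewrite !mulrA ltr_pdivrMr // -ltr_pdivrMl ?divr_gt0 // invf_div.
  by move: Bn; rewrite mulrAC.
by rewrite [X in _ < X]splitr ltrD2l.
Unshelve. all: by end_near. Qed.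

(** Evaluation at time 1 is continuous for the uniform distance. As [d] may depend on [x] in
    [unif_cont_bounded], continuity of [f] suffices for the functional [f (x k 1)]. *)
Lemma Nfreq_cvg_dist (k : nat) : (1 <= k <= K)%N ->
  cvg_dist_const c (fun n (w : Omega n) => (Nfreq K w k)%:R / n%:R) (a k 1).
Proof.
move=> kK f cf [M fM].
have i1 : (1 : R) \in `[0, 1] by rewrite in_itv /= ler01 lexx.
have e n : Expect c (fun w : Omega n => f ((Nfreq K w k)%:R / n%:R)) =
    Expect c (fun w : Omega n => f (alpha_n K w k 1)).
  by apply: eq_bigr => w _; rewrite /alpha_n mulr1 natrK.
under eq_fun do rewrite e.
apply: (solution_cvg_dist (fun x => f (x k 1))); split.
  by exists M => x.
move=> x eps eps0; have /cvgrPdist_lt/(_ eps eps0)/nbhs_ballP[d /= d0 fd] := cf (x k 1).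
by exists d => // y xy; apply: fd; exact: xy.
Qed.

End Solution.

Theorem theorem3 (R : realType) (c : R) (K : nat) (hc : 0 < c) (hK : (1 <= K)%N) :
  exists a : nat -> R -> R,
    [/\ is_solution c K a,
        (forall b : nat -> R -> R, is_solution c K b ->
           forall k t, (1 <= k <= K)%N -> t \in `[0, 1] -> b k t = a k t),
        proc_cvg_dist c K a &
        (forall k, (1 <= k <= K)%N ->
           cvg_dist_const c (fun n (w : Omega n) => (Nfreq K w k)%:R / n%:R)
             (a k 1))].
Proof.
have [a ia a_ge0] := ivp_exists c K hc.
exists a; split.
- exact: solution_of_ivp.
- move=> b /ivp_of_solution ib; apply: ivp_unique ia ib.
  by rewrite gt_eqF.
- exact: solution_cvg_dist hc ia a_ge0.
- exact: Nfreq_cvg_dist hc ia a_ge0.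
Qed.
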